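(* Let $A \in \mathbb{R}^{n\times n}$ and $\ell \in (0,1)$. The following statements are equivalent: (i) the linear mapping $\mathcal{A}: \mathbb{R}^n \to \mathbb{R}^n$, $x \mapsto Ax$, is an $\ell$-contraction with respect to some Hilbert norm on $\mathbb{R}^n$; (ii) there exists a symmetric positive definite matrix $P \in \mathbb{R}^{n \times n}$ such that $A^\top P A \preccurlyeq \ell^2 P$; (iii) every eigenvalue $\lambda \in \mathbb{C}$ of $A$ satisfies $|\lambda| \le \ell$, and every eigenvalue $\lambda$ of $A$ with $|\lambda| = \ell$ is semi-simple. Moreover, if $\ell = 1$, the previous equivalent statements (with (i) read as: $\mathcal{A}$ is $1$-Lipschitz with respect to some Hilbert norm) hold if and only if $\mathcal{A}$ is nonexpansive with respect to some Hilbert norm on $\mathbb{R}^n$.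
   Context: A Hilbert norm on $\mathbb{R}^n$ is a norm induced by an inner product (equivalently, of the form $\|x\|_P = \sqrt{x^\top P x}$ with $P$ symmetric positive definite). A mapping $\mathcal{T}:\mathbb{R}^n\to\mathbb{R}^n$ is $\ell$-Lipschitz with respect to $\|\cdot\|$ if $\|\mathcal{T}(x)-\mathcal{T}(y)\| \le \ell \|x-y\|$ for all $x,y$; it is an $\ell$-contraction if it is $\ell$-Lipschitz with $\ell \in [0,1)$, and nonexpansive if it is $\ell$-Lipschitz for some $\ell \in [0,1]$. An eigenvalue of $A$ (over $\mathbb{C}$) is semi-simple if its algebraic and geometric multiplicities are equal. $X \preccurlyeq Y$ means that $Y-X$ is positive semidefinite. *)

(* Defs.v *)
From HB Require Import structures.
From mathcomp Require Import all_boot all_order all_algebra.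
From mathcomp Require Import complex reals.

Set Implicit Arguments.
Unset Strict Implicit.
Unset Printing Implicit Defensive.

Import Order.TTheory GRing.Theory Num.Theory.
Local Open Scope ring_scope.

(* {dot V for idfun} is the type of symmetric, positive definite bilinear
   forms on V, i.e. of real inner products. *)
Definition hilbert_norm (R : rcfType) (n : nat) (N : 'cV[R]_n -> R) : Prop :=
  exists ip : {dot 'cV[R]_n for idfun}, forall x, N x = Num.sqrt (ip x x).

Definition lipschitz_wrt (R : rcfType) (n : nat) (N : 'cV[R]_n -> R) (l : R)
    (T : 'cV[R]_n -> 'cV[R]_n) : Prop :=
  forall x y, N (T x - T y) <= l * N (x - y).

Definition contraction_wrt (R : rcfType) (n : nat) (N : 'cV[R]_n -> R) (l : R)
    (T : 'cV[R]_n -> 'cV[R]_n) : Prop :=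
  0 <= l < 1 /\ lipschitz_wrt N l T.

Definition nonexpansive_wrt (R : rcfType) (n : nat) (N : 'cV[R]_n -> R)
    (T : 'cV[R]_n -> 'cV[R]_n) : Prop :=
  exists l : R, 0 <= l <= 1 /\ lipschitz_wrt N l T.

Definition posdefmx (R : rcfType) (n : nat) (P : 'M[R]_n) : Prop :=
  P \is symmetricmx /\
  forall x : 'cV[R]_n, x != 0 -> 0 < (x^T *m P *m x) 0 0.

Definition possemidefmx (R : rcfType) (n : nat) (P : 'M[R]_n) : Prop :=
  P \is symmetricmx /\
  forall x : 'cV[R]_n, 0 <= (x^T *m P *m x) 0 0.

Definition loewner_le (R : rcfType) (n : nat) (X Y : 'M[R]_n) : Prop :=
  possemidefmx (Y - X).

Definition complexmx (R : rcfType) (n : nat) (A : 'M[R]_n) : 'M[R[i]]_n :=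
  map_mx (real_complex R) A.

(* [eigenvalue] and [eigenspace] refer to the action v |-> v *m A on row
   vectors; the transpose turns it into the action x |-> A *m x on columns. *)
Definition col_eigenvalue (F : fieldType) (n : nat) (A : 'M[F]_n) (a : F) :
  bool := eigenvalue A^T a.

Definition geometric_mult (F : fieldType) (n : nat) (A : 'M[F]_n) (a : F) :
  nat := \rank (eigenspace A^T a).

Definition algebraic_mult (F : fieldType) (n : nat) (A : 'M[F]_n) (a : F) :
  nat := mup a (char_poly A).

Definition semi_simple (F : fieldType) (n : nat) (A : 'M[F]_n) (a : F) :
  Prop := algebraic_mult A a = geometric_mult A a.

(* Main.v *)
Require Import Defs.
From HB Require Import structures.
From mathcomp Require Import all_boot all_order all_algebra.
From mathcomp Require Import complex reals.
From mathcomp Require Import boolp ring lra.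

(* Row vectors are used throughout, so M stands for the transpose of A over C.
   An eigenvalue a is semi-simple iff v (M - a)^2 = 0 implies v (M - a) = 0: in
   a basis extending one of the a-eigenspace, M is block lower triangular with
   diagonal blocks a I and B, and both conditions say that a is not an
   eigenvalue of B.
   For (ii) => (iii), extend the quadratic form of P to complex rows.  It
   controls the moduli of the eigenvalues, and a generalized eigenvector of rank
   two for an eigenvalue of modulus l would give a line along which the form is
   a nonincreasing quadratic polynomial with positive leading coefficient.
   For (iii) => (ii), split off the eigenvalues of modulus l one at a time:
   B - a is invertible, so the coupling block can be removed exactly.  The
   remaining eigenvalues have modulus < l, and there the coupling block is
   absorbed by giving the eigenvector coordinates a small weight.  The resulting
   complex basis S gives the real P = Re S (Re S)^T + Im S (Im S)^T. *)

Set Implicit Arguments.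
Unset Strict Implicit.
Unset Printing Implicit Defensive.

Import Order.TTheory GRing.Theory Num.Theory.
Local Open Scope ring_scope.

(** * Semi-simple eigenvalues *)

(** No Jordan block of [M] at [a] has size two or more; this is trivially true if [a] is not an
    eigenvalue. *)
Definition ascent_le1 (F : fieldType) n (M : 'M[F]_n) (a : F) : Prop :=
  forall v : 'rV_n,
    v *m (M - a%:M) *m (M - a%:M) = 0 -> v *m (M - a%:M) = 0.

Section Similarity.
Variables (F : fieldType) (n : nat).
Implicit Types M N S : 'M[F]_n.

Lemma char_poly_similar M N S :
  S \in unitmx -> S *m M = N *m S -> char_poly M = char_poly N.
Proof.
move=> uS SM; have dS : (\det S)%:P != 0 :> {poly F}.
  by rewrite polyC_eq0 -unitfE -unitmxE.
(* Both sides are multiplied by the nonzero constant polynomial [\det S], so no inverse of [S] over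
   the polynomials is needed. *)
apply: (mulfI dS); rewrite [RHS]mulrC -det_map_mx -!det_mulmx.
rewrite /char_poly_mx mulmxBr mulmxBl -!map_mxM SM.
by rewrite mul_mx_scalar mul_scalar_mx.
Qed.

Lemma similar_sub_scalar M N S a :
  S *m M = N *m S -> S *m (M - a%:M) = (N - a%:M) *m S.
Proof.
by move=> SM; rewrite mulmxBr mulmxBl SM mul_mx_scalar mul_scalar_mx.
Qed.

Lemma ascent_le1_similar M N S a :
  S \in unitmx -> S *m M = N *m S -> ascent_le1 M a -> ascent_le1 N a.
Proof.
move=> uS /(@similar_sub_scalar _ _ _ a) SM aM v vN.
apply: (can_inj (mulmxK uS)); rewrite mul0mx -mulmxA -SM mulmxA.
by apply: aM; rewrite -[v *m S *m _]mulmxA SM mulmxA -mulmxA SM mulmxA vN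
  mul0mx.
Qed.

Lemma similar_sym M N S :
  S \in unitmx -> S *m M = N *m S -> invmx S *m N = M *m invmx S.
Proof.
by move=> uS SM; rewrite -[M](mulKmx uS) SM !mulmxA mulmxK.
Qed.

End Similarity.

Lemma eigenvalueN_unit (F : fieldType) n (B : 'M[F]_n) a :
  ~~ eigenvalue B a -> B - a%:M \in unitmx.
Proof. by rewrite /eigenvalue negbK kermx_eq0 row_free_unit. Qed.

(** * Block form adapted to one eigenspace *)

Section EigenspaceBlock.
Variables (F : fieldType) (r m : nat).
Implicit Types (W : 'M[F]_(m, r)) (B : 'M[F]_m).

(** The rows of [S] extend a basis of the [a]-eigenspace, placed first, to the whole space; [M]
    multiplies those first [r] rows by [a], which fixes the upper blocks. *)
Lemma eigenspace_block (M : 'M[F]_(r + m)) a : \rank (eigenspace M a) = r ->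
  exists S W B, S \in unitmx /\ S *m M = block_mx a%:M 0 W B *m S.
Proof.
move=> rM; have [K rK KM] : exists2 K : 'M_(r + m), \rank K = r & K *m (M -
  a%:M) = 0.
  by exists (eigenspace M a); rewrite ?mulmx_ker.
pose S := row_ebase K.
have uS : S \in unitmx by exact: row_ebase_unit.
(* The first [r] rows of [S] lie in the row space of [K], because [pid_mx r *m S] is [K] up to an
   invertible left factor. *)
have S0 : usubmx S *m (M - a%:M) = 0.
  have -> : usubmx S = row_mx 1%:M 0 *m (pid_mx r : 'M_(r + m)) *m S.
    rewrite pid_mx_block mul_row_block !mulmx1 !mulmx0 !addr0.
    by rewrite -[S in RHS]vsubmxK mul_row_col mul1mx mul0mx addr0.
  have pS : (pid_mx r : 'M_(r + m)) *m S = invmx (col_ebase K) *m K.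
    by rewrite -[X in _ = _ *m X]mulmx_ebase rK -mulmxA mulKmx ?col_ebase_unit.
  rewrite -[_ *m S]mulmxA pS -!mulmxA.
  by rewrite KM !mulmx0.
pose N := S *m M *m invmx S.
exists S, (dlsubmx N), (drsubmx N); split=> //.
suff <- : N = block_mx a%:M 0 (dlsubmx N) (drsubmx N) by rewrite mulmxKV.
rewrite -[LHS]submxK; suff : usubmx N = row_mx a%:M 0.
  by rewrite -[usubmx N]hsubmxK => /eq_row_mx [<- <-].
rewrite -!mul_usub_mx; move/eqP: S0; rewrite mulmxBr subr_eq0 => /eqP ->.
rewrite mul_mx_scalar -scalemxAl mul_usub_mx mulmxV //.
by rewrite (@scalar_mx_block _ r m) /block_mx col_mxKu scale_row_mx scalemx1
  scaler0.
Qed.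

Lemma char_poly_lblock a W B :
  char_poly (block_mx (a%:M : 'M_r) 0 W B) = ('X - a%:P) ^+ r * char_poly B.
Proof.
rewrite /char_poly /char_poly_mx map_block_mx map_scalar_mx /= map_mx0.
by rewrite (@scalar_mx_block _ r m 'X) opp_block_mx add_block_mx !oppr0 !addr0
  det_lblock -raddfB /= det_scalar.
Qed.

Lemma mup_char_poly_lblock a W B :
  mup a (char_poly (block_mx (a%:M : 'M_r) 0 W B)) = r <-> ~~ eigenvalue B a.
Proof.
have pB : char_poly B != 0 by rewrite -size_poly_eq0 size_char_poly.
rewrite char_poly_lblock mupM ?expf_neq0 ?polyXsubC_eq0 //.
rewrite mup_XsubCX eqxx eigenvalue_root_char; split=> [|/mupNroot -> //].
  move=> /eqP; rewrite -[X in _ == X]addn0 eqn_add2l => /eqP mB.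
  by rewrite -dvdp_XsubCl XsubC_dvd ?mB.
by rewrite addn0.
Qed.

Lemma mul_row_lblock_sub a W B (x : 'rV_r) (y : 'rV_m) :
  row_mx x y *m (block_mx a%:M 0 W B - a%:M) =
  row_mx (y *m W) (y *m (B - a%:M)).
Proof.
rewrite (@scalar_mx_block _ r m a) opp_block_mx add_block_mx mul_row_block.
by rewrite subrr !subr0 !mulmx0 !add0r.
Qed.

(** By the rank hypothesis the eigenspace consists exactly of the rows [(x, 0)]. If [y] is an
    [a]-eigenvector of [B], then [(0, y)] is killed by the square of [N - a], but it is not of that
    form. Conversely, if [B - a] is invertible, a row killed by the square has zero second part. *)
Lemma ascent_le1_lblock a W B :
  \rank (eigenspace (block_mx (a%:M : 'M_r) 0 W B) a) = r ->
  ascent_le1 (block_mx (a%:M : 'M_r) 0 W B) a <-> ~~ eigenvalue B a.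
Proof.
set N := block_mx _ _ _ _ => rN; split=> [aN|/eigenvalueN_unit uB v];
  last first.
  rewrite -[v]hsubmxK !mul_row_lblock_sub -[0]hsubmxK !linear0 => /eq_row_mx[_].
  move=> /(canRL (mulmxK uB)); rewrite mul0mx => /(canRL (mulmxK uB)) ->.
  by rewrite !mul0mx row_mx0.
apply/eigenvalueP => -[y yB y0]; have yB0 : y *m (B - a%:M) = 0.
  by rewrite mulmxBr yB mul_mx_scalar subrr.
have sub : (row_mx 0 y <= eigenspace N a)%MS.
  apply/sub_kermxP/aN; rewrite !mul_row_lblock_sub yB0 !mul0mx row_mx0 //.
have subI : (row_mx 1%:M 0 <= eigenspace N a)%MS.
  apply/sub_kermxP; apply/row_matrixP => i.
  by rewrite row_mul row_row_mx row0 mul_row_lblock_sub !mul0mx row0 row_mx0.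
have : (eigenspace N a <= row_mx (1%:M : 'M_r) (0 : 'M_(r, m)))%MS.
  have rI : \rank (row_mx (1%:M : 'M[F]_r) (0 : 'M_(r, m))) = r.
    by rewrite rank_row_mx0 mxrank1.
  by rewrite -(geq_leqif (mxrank_leqif_sup subI)) rI rN.
move=> /(submx_trans sub) /submxP[D];
  rewrite mul_mx_row mulmx0 => /eq_row_mx[_].
by move/eqP: y0.
Qed.

End EigenspaceBlock.

Lemma eigenspace_similar (F : fieldType) n (M N S : 'M[F]_n) a :
  S \in unitmx -> S *m M = N *m S ->
  \rank (eigenspace N a) = \rank (eigenspace M a).
Proof.
move=> uS /(@similar_sub_scalar _ _ _ _ _ a) SM; rewrite !mxrank_ker.
rewrite -(@mxrankMfree _ _ _ _ (N - a%:M) S) ?row_free_unit // -SM.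
by rewrite (eqmxMfull (M - a%:M)) // row_full_unit.
Qed.

Lemma mup_eigenspace_ascent (F : fieldType) n (M : 'M[F]_n) a :
  mup a (char_poly M) = \rank (eigenspace M a) <-> ascent_le1 M a.
Proof.
have [r [m [en rM]]] : exists r m, n = (r + m)%N /\ \rank (eigenspace M a) = r.
  exists (\rank (eigenspace M a)), (n - \rank (eigenspace M a))%N.
  by rewrite subnKC ?rank_leq_row.
(* The size has to be syntactically a sum before block matrices make sense. *)
move: M rM; rewrite en => M rM.
have [S [W [B [uS SM]]]] := eigenspace_block rM.
rewrite (char_poly_similar uS SM) rM mup_char_poly_lblock.
rewrite -(@ascent_le1_lblock _ _ _ a W) ?(eigenspace_similar a uS SM) //.
split; last exact: ascent_le1_similar SM.
by apply: ascent_le1_similar (similar_sym uS SM); rewrite unitmx_inv.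
Qed.

(** * Bounding a complex matrix in an adapted basis *)

Section SquaredNorm.
Variable R : rcfType.
Notation C := R[i].

(** Squared modulus with values in [R] rather than [R[i]], so that estimates are polynomial
    inequalities over a real field. *)
Definition sqc (c : C) : R := complex.Re c ^+ 2 + complex.Im c ^+ 2.

Definition sqn n (v : 'rV[C]_n) : R := \sum_j sqc (v 0 j).

Lemma sqc_ge0 c : 0 <= sqc c.
Proof. by rewrite addr_ge0 ?sqr_ge0. Qed.

Lemma sqcM c d : sqc (c * d) = sqc c * sqc d.
Proof. by case: c => a b; case: d => e f; rewrite /sqc /=; ring. Qed.

Lemma sqc_eq0 c : (sqc c == 0) = (c == 0).
Proof.
case: c => a b; rewrite /sqc /= paddr_eq0 ?sqr_ge0 // !sqrf_eq0.
by rewrite eq_complex.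
Qed.

Lemma sqc_real (a : R) : sqc (real_complex R a) = a ^+ 2.
Proof. by rewrite /sqc /= expr0n addr0. Qed.

Lemma normc_le_sqc c (l : R) : 0 <= l ->
  (`|c| <= real_complex R l) = (sqc c <= l ^+ 2).
Proof.
by move=> l0; rewrite normc_def lecR -(ler_sqr (sqrtr_ge0 _) l0) sqr_sqrtr
  ?sqc_ge0.
Qed.

Lemma normc_eq_sqc c (l : R) : 0 <= l ->
  `|c| = real_complex R l <-> sqc c = l ^+ 2.
Proof.
move=> l0; rewrite normc_def; split=> [[<-]|];
  first by rewrite sqr_sqrtr ?sqc_ge0.
by rewrite /sqc => ->; rewrite sqrtr_sqr ger0_norm.
Qed.

(** Young's inequality: on real numbers the difference of the two sides is
    [d * (x - d^-1 * y) ^+ 2]. A small [d] keeps the factor of [sqc a] close to 1. *)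
Lemma sqcD (d : R) a b : 0 < d ->
  sqc (a + b) <= (1 + d) * sqc a + (1 + d^-1) * sqc b.
Proof.
have aux (x y : R) : 0 < d ->
    (x + y) ^+ 2 <= (1 + d) * x ^+ 2 + (1 + d^-1) * y ^+ 2.
  move=> d0; rewrite -subr_ge0.
  have -> : (1 + d) * x ^+ 2 + (1 + d^-1) * y ^+ 2 - (x + y) ^+ 2 =
            d * (x - d^-1 * y) ^+ 2.
    by field; rewrite gt_eqF.
  by rewrite mulr_ge0 ?sqr_ge0 // ltW.
move=> d0; case: a => a a'; case: b => b b'; rewrite /sqc /=.
by have := aux a b d0; have := aux a' b' d0; lra.
Qed.

Section Rows.
Variable n : nat.
Implicit Types u v : 'rV[C]_n.

Lemma sqn_ge0 v : 0 <= sqn v.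
Proof. by apply: sumr_ge0 => j _; exact: sqc_ge0. Qed.

Lemma sqn0 : sqn (0 : 'rV_n) = 0.
Proof. by apply: big1 => j _; rewrite mxE; apply/eqP; rewrite sqc_eq0. Qed.

Lemma sqn_eq0 v : (sqn v == 0) = (v == 0).
Proof.
apply/eqP/eqP => [/eqP|->]; last exact: sqn0.
rewrite psumr_eq0 => [/allP v0|j _]; last exact: sqc_ge0.
apply/rowP => j; rewrite mxE; apply/eqP; rewrite -sqc_eq0.
by apply: v0; rewrite mem_index_enum.
Qed.

Lemma sqnZ c v : sqn (c *: v) = sqc c * sqn v.
Proof. by rewrite mulr_sumr; apply: eq_bigr => j _; rewrite mxE sqcM. Qed.

Lemma sqnD (d : R) u v : 0 < d ->
  sqn (u + v) <= (1 + d) * sqn u + (1 + d^-1) * sqn v.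
Proof.
move=> d0; rewrite !mulr_sumr -big_split /=.
by apply: ler_sum => j _; rewrite mxE sqcD.
Qed.

Lemma sqc_le_sqn v j : sqc (v 0 j) <= sqn v.
Proof.
by rewrite /sqn (bigD1 j) //= lerDl; apply: sumr_ge0 => i _; exact: sqc_ge0.
Qed.

End Rows.

Lemma sqn_mulmx_bound n m (W : 'M[C]_(n, m)) :
  exists2 c : R, 0 <= c & forall v : 'rV_n, sqn (v *m W) <= c * sqn v.
Proof.
(* The sum over all rows is generalized to a sum over any list of indices, for induction; each new
   row costs a factor 2, from [sqnD] with [d = 1]. *)
suff [c c0 cP] : exists2 c : R, 0 <= c & forall v : 'rV_n,
    sqn (\sum_(i <- index_enum 'I_n) v 0 i *: row i W) <= c * sqn v.
  by exists c => // v; rewrite mulmx_sum_row.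
elim: (index_enum _) => [|i s [c c0 IH]].
  by exists 0 => // v; rewrite big_nil mul0r sqn0.
exists (2 * sqn (row i W) + 2 * c) => [|v].
  by rewrite addr_ge0 ?mulr_ge0 ?sqn_ge0.
rewrite big_cons; apply: le_trans (sqnD _ _ ltr01) _.
rewrite sqnZ invr1; have := IH v; have := sqc_le_sqn v i.
have := sqn_ge0 (row i W); set w := sqn (row i W);
  set s1 := sqn (\sum_(_ <- _) _).
nra.
Qed.

Lemma sqn_row_mx n m (u : 'rV[C]_n) (v : 'rV_m) :
  sqn (row_mx u v) = sqn u + sqn v.
Proof.
rewrite /sqn big_split_ord /=; congr (_ + _); apply: eq_bigr => j _.
  by rewrite row_mxEl.
by rewrite row_mxEr.
Qed.

End SquaredNorm.

(** * Complex matrices bounded in a suitable basis *)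

Section BoundedSimilarity.
Variable R : rcfType.
Notation C := R[i].

(** [k] is a bound on the squared operator norm of [M] for the Hilbert norm pulled back along
    [S]. *)
Definition bounded_upto_basis n (M : 'M[C]_n) (k : R) : Prop :=
  exists2 S, S \in unitmx &
    forall v : 'rV_n, sqn (v *m M *m S) <= k * sqn (v *m S).

Lemma bounded_upto_basis_similar n (M N T : 'M[C]_n) k :
  T \in unitmx -> T *m M = N *m T ->
  bounded_upto_basis N k -> bounded_upto_basis M k.
Proof.
move=> uT TM [S uS SP]; exists (invmx T *m S).
  by rewrite unitmx_mul unitmx_inv uT.
move=> v; have := SP (v *m invmx T).
by rewrite -!mulmxA !(mulmxA M) -(similar_sym uT TM) !mulmxA.
Qed.

Lemma unitmx_block_diag (F : fieldType) r m (S : 'M[F]_r) (T : 'M_m) :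
  S \in unitmx -> T \in unitmx -> block_mx S 0 0 T \in unitmx.
Proof. by rewrite !unitmxE det_lblock unitrM => -> ->. Qed.

Lemma eigenvalue_lblock (F : fieldType) r m (M : 'M[F]_(r + m)) S a W B b :
  S \in unitmx -> S *m M = block_mx a%:M 0 W B *m S ->
  eigenvalue B b -> eigenvalue M b.
Proof.
move=> uS SM; rewrite !eigenvalue_root_char (char_poly_similar uS SM).
by rewrite char_poly_lblock rootM => ->; rewrite orbT.
Qed.

Lemma eigenvalue_exists n (M : 'M[C]_n) : (0 < n)%N -> exists a, eigenvalue M a.
Proof.
move=> n0; have /closed_rootP[a] : size (char_poly M) != 1.
  by rewrite size_char_poly; case: n n0 M.
by rewrite -eigenvalue_root_char => ea; exists a.
Qed.

Lemma eigenspace_split (F : fieldType) n (M : 'M[F]_n) a : eigenvalue M a ->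
  exists r m, [/\ n = (r + m)%N, (0 < r)%N & \rank (eigenspace M a) = r].
Proof.
rewrite /eigenvalue -mxrank_eq0 -lt0n => r0.
exists (\rank (eigenspace M a)), (n - \rank (eigenspace M a))%N.
by rewrite subnKC ?rank_leq_row.
Qed.

Lemma bounded_upto_basis_thin (M : 'M[C]_0) k : bounded_upto_basis M k.
Proof.
by exists 1%:M => [|v]; rewrite ?unitmx1 // /sqn !big_ord0 mulr0.
Qed.

(* A small weight on the eigenvector coordinates absorbs the coupling block. *)
Lemma bounded_upto_basis_lt n (M : 'M[C]_n) (k : R) : 0 < k ->
  (forall a, eigenvalue M a -> sqc a < k) ->
  exists2 k', 0 <= k' < k & bounded_upto_basis M k'.
Proof.
(* The conclusion asks for [k' < k] because the induction step spends the gap [k - k1] on the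
   coupling block. *)
move=> k0; elim/ltn_ind: n M => n IH M eM.
have [n0|/(eigenvalue_exists M) [a ea]] := posnP n.
  subst n; exists 0; first by rewrite lexx k0.
  exact: bounded_upto_basis_thin.
have [r [m [en r0 rM]]] := eigenspace_split ea.
subst n; have [T [W [B [uT TM]]]] := eigenspace_block rM.
have [|b eb|k1 /andP[k1_ge0 k1_lt] [S uS SP]] := IH m _ B.
- by rewrite -[X in (X < _)%N]add0n ltn_add2r.
- exact/eM/(eigenvalue_lblock uT TM).
(* The coupling [y *m W] is measured against [y *m S], the norm in which [B] is bounded. *)
have [c c0 cP] := sqn_mulmx_bound (invmx S *m W).
have := eM a ea; have := sqc_ge0 a; set s := sqc a => s0 sk.
(* Small enough that the Young factor [1 + d] keeps [(1 + d) * s] below [k]. *)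
pose d := (k - s) / (2 * k).
have d0 : 0 < d by rewrite divr_gt0 ?mulr_gt0 ?subr_gt0.
have ds : (1 + d) * s < k.
  rewrite -subr_gt0; have -> : k - (1 + d) * s = (k - s) * (2 * k - s) / (2 *
    k).
    by rewrite /d; field; rewrite gt_eqF.
  by rewrite divr_gt0 ?mulr_gt0 //; lra.
pose g := (1 + d^-1) * c.
have g0 : 0 <= g by rewrite mulr_ge0 // addr_ge0 // invr_ge0 ltW.
(* The weight of the eigenvector coordinates, chosen so that [e ^+ 2 * g] fits in the gap [k - k1];
   the summand 1 keeps [e < 1] even if [g = 0]. *)
pose e := (k - k1) / (k - k1 + g + 1).
have den0 : 0 < k - k1 + g + 1 by lra.
have e0 : 0 < e by rewrite divr_gt0 // subr_gt0.
have e1 : e < 1 by rewrite ltr_pdivrMr //; lra.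
have eg : e * g < k - k1.
  by rewrite mulrAC ltr_pdivrMr // ltr_pM2l ?subr_gt0 //; lra.
have e2g : e ^+ 2 * g < k - k1.
  apply: le_lt_trans eg; rewrite expr2 -mulrA.
  by apply: ler_piMl; [apply: mulr_ge0 => // |]; apply: ltW.
pose k2 := Num.max ((1 + d) * s) (k1 + e ^+ 2 * g).
have le_k2l : (1 + d) * s <= k2 by rewrite le_max lexx.
have le_k2r : k1 + e ^+ 2 * g <= k2 by rewrite le_max lexx orbT.
exists k2.
  rewrite gt_max ds /=; apply/andP; split; last by lra.
  by apply: le_trans le_k2l; rewrite mulr_ge0 //; lra.
apply: bounded_upto_basis_similar uT TM _.
exists (block_mx (real_complex R e)%:M 0 0 S).
  rewrite unitmx_block_diag // unitmxE det_scalar unitrX // unitfE.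
  by rewrite -sqc_eq0 sqc_real sqrf_eq0 gt_eqF.
move=> v; rewrite -[v]hsubmxK; move: (lsubmx v) (rsubmx v) => x y {v}.
rewrite !mul_row_block !mulmx0 !addr0 !add0r !mul_mx_scalar !sqn_row_mx !sqnZ
  sqc_real.
have := sqnD (a *: x) (y *m W) d0; rewrite sqnZ -/s.
have := cP (y *m S); rewrite -!mulmxA mulKVmx // => yW.
have := SP y; have := sqn_ge0 x; have := sqn_ge0 (y *m S).
rewrite -!mulmxA.
move: yW; move: (sqn x) (sqn (y *m W)) (sqn (y *m S)) (sqn (_ + _)) (sqn (y *m
  (B *m S))).
(* With [Z] the squared norm of [a *: x + y *m W], the goal reads
   [e ^+ 2 * Z + YB <= k2 * (e ^+ 2 * X + Y)]; the [X] and [Y] contributions are bounded separately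
   by the two arguments of the maximum [k2]. *)
move=> X YW Y Z YB YWle Y0 X0 YBle Zle.
have E0 := sqr_ge0 e.
have YWg : (1 + d^-1) * YW <= g * Y.
  rewrite /g -mulrA; apply: ler_wpM2l YWle.
  by rewrite addr_ge0 // invr_ge0 ltW.
have EZ : e ^+ 2 * Z <= e ^+ 2 * ((1 + d) * s * X + g * Y).
  by rewrite ler_wpM2l //; lra.
have EX : e ^+ 2 * ((1 + d) * s * X) <= e ^+ 2 * (k2 * X).
  by rewrite ler_wpM2l // ler_wpM2r.
have YY : (k1 + e ^+ 2 * g) * Y <= k2 * Y by rewrite ler_wpM2r.
lra.
Qed.

(** When [sqc a = k] there is no slack to absorb a coupling block, so it has to vanish after a
    change of basis; the ascent condition makes this possible. *)
Lemma bounded_upto_basis_le n (M : 'M[C]_n) (k : R) : 0 < k ->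
  (forall a, eigenvalue M a -> sqc a <= k) ->
  (forall a, eigenvalue M a -> sqc a = k -> ascent_le1 M a) ->
  bounded_upto_basis M k.
Proof.
move=> k0; elim/ltn_ind: n M => n IH M eM aM.
have [[a ea ak]|no] := EM (exists2 a, eigenvalue M a & sqc a = k); last first.
  have [a ea|k' /andP[_ k'_lt] [S uS SP]] := bounded_upto_basis_lt k0 (M := M).
    rewrite lt_neqAle eM // andbT; apply/eqP => ak.
    by apply: no; exists a.
  exists S => // v; apply: le_trans (SP v) _.
  by rewrite ler_wpM2r ?sqn_ge0 // ltW.
have [r [m [en r0 rM]]] := eigenspace_split ea.
subst n; have [T [W [B [uT TM]]]] := eigenspace_block rM.
have /eigenvalueN_unit uB : ~~ eigenvalue B a.
  rewrite -(@ascent_le1_lblock _ _ _ a W) ?(eigenspace_similar a uT TM) //.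
  exact: ascent_le1_similar TM (aM a ea ak).
pose D := block_mx (a%:M : 'M_r) 0 0 B.
(* The lower left block [Z] solves the Sylvester equation [a Z + W = B Z], that is
   [(B - a) Z = W]. *)
pose U := block_mx (1%:M : 'M_r) 0 (invmx (B - a%:M) *m W) 1%:M.
have uU : U \in unitmx by rewrite unitmxE det_lblock !det1 mulr1 unitr1.
have UN : U *m block_mx a%:M 0 W B = D *m U.
  rewrite !mulmx_block !mul1mx !mulmx1 !mulmx0 !mul0mx !addr0 !add0r
    mul_mx_scalar.
  congr block_mx; rewrite -[W in _ + W](mulKVmx uB) mulmxBl mul_scalar_mx.
  by rewrite addrC subrK.
pose V := U *m T.
have uV : V \in unitmx by rewrite unitmx_mul uU.
have VM : V *m M = D *m V by rewrite -mulmxA TM mulmxA UN -mulmxA.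
have [|b eb|b eb bk y yB|S uS SP] := IH m _ B.
- by rewrite -[X in (X < _)%N]add0n ltn_add2r.
- exact/eM/(eigenvalue_lblock uT TM).
(* As [D] is block diagonal, [B] inherits the ascent condition through the rows [(0, y)]. *)
- have aD := ascent_le1_similar uV VM (aM b (eigenvalue_lblock uT TM eb) bk).
  have DbE z : row_mx 0 z *m (D - b%:M) = row_mx 0 (z *m (B - b%:M)).
    rewrite (@scalar_mx_block _ r m b) opp_block_mx add_block_mx mul_row_block.
    by rewrite !subr0 !mul0mx !mulmx0 !add0r.
  have := aD (row_mx 0 y); rewrite !DbE yB row_mx0 => /(_ erefl).
  by move/(congr1 rsubmx); rewrite row_mxKr linear0.
apply: bounded_upto_basis_similar uV VM _.
exists (block_mx 1%:M 0 0 S); first by rewrite unitmx_block_diag ?unitmx1.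
move=> v; rewrite -[v]hsubmxK; move: (lsubmx v) (rsubmx v) => x y {v}.
rewrite !mul_row_block !mulmx0 !mulmx1 !addr0 !add0r mul_mx_scalar !sqn_row_mx.
by rewrite sqnZ ak mulrDr lerD2l.
Qed.

End BoundedSimilarity.

(** * Real and complexified quadratic forms *)

Section RealImaginaryParts.
Variable R : rcfType.
Notation C := R[i].
Notation Remx := (map_mx (@complex.Re R)).
Notation Immx := (map_mx (@complex.Im R)).

Lemma Re_sum I (s : seq I) (F : I -> C) :
  complex.Re (\sum_(i <- s) F i) = \sum_(i <- s) complex.Re (F i).
Proof. by apply: (big_morph (@complex.Re R)) => // -[a b] [c d]. Qed.

Lemma Im_sum I (s : seq I) (F : I -> C) :
  complex.Im (\sum_(i <- s) F i) = \sum_(i <- s) complex.Im (F i).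
Proof. by apply: (big_morph (@complex.Im R)) => // -[a b] [c d]. Qed.

Lemma Remx_mulr m n p (v : 'M[C]_(m, n)) (T : 'M[R]_(n, p)) :
  Remx (v *m map_mx (real_complex R) T) = Remx v *m T.
Proof.
apply/matrixP => i j; rewrite !mxE Re_sum; apply: eq_bigr => k _.
by rewrite !mxE; case: (v i k) => a b /=; rewrite mulr0 subr0.
Qed.

Lemma Immx_mulr m n p (v : 'M[C]_(m, n)) (T : 'M[R]_(n, p)) :
  Immx (v *m map_mx (real_complex R) T) = Immx v *m T.
Proof.
apply/matrixP => i j; rewrite !mxE Im_sum; apply: eq_bigr => k _.
by rewrite !mxE; case: (v i k) => a b /=; rewrite mulr0 add0r.
Qed.

Lemma Remx_mull m n p (T : 'M[R]_(m, n)) (S : 'M[C]_(n, p)) :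
  Remx (map_mx (real_complex R) T *m S) = T *m Remx S.
Proof.
apply/matrixP => i j; rewrite !mxE Re_sum; apply: eq_bigr => k _.
by rewrite !mxE; case: (S k j) => a b /=; rewrite mul0r subr0.
Qed.

Lemma Immx_mull m n p (T : 'M[R]_(m, n)) (S : 'M[C]_(n, p)) :
  Immx (map_mx (real_complex R) T *m S) = T *m Immx S.
Proof.
apply/matrixP => i j; rewrite !mxE Im_sum; apply: eq_bigr => k _.
by rewrite !mxE; case: (S k j) => a b /=; rewrite mul0r addr0.
Qed.

Lemma sqn_Remx_Immx n (v : 'rV[C]_n) :
  sqn v = (Remx v *m (Remx v)^T + Immx v *m (Immx v)^T) 0 0.
Proof.
rewrite !mxE -big_split; apply: eq_bigr => j _.
by rewrite !mxE /sqc !expr2.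
Qed.

Lemma symmetricmxP n (P : 'M[R]_n) : reflect (P^T = P) (P \is symmetricmx).
Proof.
by apply: (iffP (is_hermitianmxP _ _ _)); rewrite expr0 scale1r map_mx_id.
Qed.

(** The real part of [S] times its conjugate transpose; the imaginary part is antisymmetric and
    vanishes as a quadratic form on real vectors. *)
Definition gram_mx n (S : 'M[C]_n) : 'M[R]_n :=
  Remx S *m (Remx S)^T + Immx S *m (Immx S)^T.

Lemma gram_mxE n (S : 'M[C]_n) (x : 'cV[R]_n) :
  (x^T *m gram_mx S *m x) 0 0 = sqn (map_mx (real_complex R) x^T *m S).
Proof.
rewrite sqn_Remx_Immx Remx_mull Immx_mull /gram_mx !trmx_mul trmxK.
by rewrite mulmxDr mulmxDl !mulmxA.
Qed.

Lemma gram_mx_posdef n (S : 'M[C]_n) : S \in unitmx -> posdefmx (gram_mx S).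
Proof.
move=> uS; split=> [|x x0].
  by apply/symmetricmxP; rewrite linearD /= !trmx_mul !trmxK.
rewrite gram_mxE lt_def sqn_ge0 andbT sqn_eq0; apply: contraNneq x0 => xS.
have : map_mx (real_complex R) x^T = 0.
  by apply: (can_inj (mulmxK uS)); rewrite xS mul0mx.
by move/eqP; rewrite map_mx_eq0 trmx_eq0.
Qed.

(** The complex bound is only evaluated at real rows, where [gram_mxE] turns it into the quadratic
    form of [gram_mx S]. *)
Lemma bounded_upto_basis_loewner n (A : 'M[R]_n) k :
  bounded_upto_basis (complexmx A)^T k ->
  exists2 P, posdefmx P & loewner_le (A^T *m P *m A) (k *: P).
Proof.
move=> [S uS SP]; have pP := gram_mx_posdef uS.
exists (gram_mx S) => //; split.
  have [/symmetricmxP sP _] := pP.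
  by apply/symmetricmxP; rewrite linearB linearZ /= !trmx_mul trmxK sP mulmxA.
move=> x; rewrite mulmxBr mulmxBl mxE [X in _ + X]mxE.
have -> : x^T *m (A^T *m gram_mx S *m A) *m x = (A *m x)^T *m gram_mx S *m (A
  *m x).
  by rewrite trmx_mul !mulmxA.
rewrite -scalemxAr -scalemxAl mxE !gram_mxE subr_ge0.
rewrite trmx_mul map_mxM; have := SP (map_mx (real_complex R) x^T).
by rewrite /complexmx map_trmx.
Qed.

(** * The quadratic form of [P] on complex rows *)

Section Complexification.
Variables (n : nat) (P : 'M[R]_n).
Implicit Types (x y : 'rV[R]_n) (v w : 'rV[C]_n).

Definition bilin x y : R := (x *m P *m y^T) 0 0.

(** For symmetric [P] this is the Hermitian form [v P] times the conjugate transpose of [v]. *)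
Definition complexified_form v : R :=
  bilin (Remx v) (Remx v) + bilin (Immx v) (Immx v).

Lemma bilin_comb (a b : R) x y :
  bilin (a *: x + b *: y) (a *: x + b *: y) =
  a ^+ 2 * bilin x x + a * b * (bilin x y + bilin y x) + b ^+ 2 * bilin y y.
Proof.
rewrite /bilin linearD !linearZ /= !(mulmxDl, mulmxDr) -!scalemxAl -!scalemxAr.
by rewrite !mxE; ring.
Qed.

Lemma complexified_formZ (c : C) v :
  complexified_form (c *: v) = sqc c * complexified_form v.
Proof.
rewrite /complexified_form.
have -> : Remx (c *: v) = complex.Re c *: Remx v + (- complex.Im c) *: Immx v.
  apply/rowP => j; rewrite !mxE; case: c (v 0 j) => a b [d e] /=.
  by rewrite mulNr.
have -> : Immx (c *: v) = complex.Re c *: Immx v + complex.Im c *: Remx v.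
  by apply/rowP => j; rewrite !mxE; case: c (v 0 j) => a b [d e] /=.
by rewrite !bilin_comb /sqc; ring.
Qed.

(** The linear coefficient [q] stays anonymous: only its independence of [s] matters. *)
Lemma complexified_form_line v w : exists q, forall s : R,
  complexified_form (v + real_complex R s *: w) =
  complexified_form v + s * q + s ^+ 2 * complexified_form w.
Proof.
exists (bilin (Remx v) (Remx w) + bilin (Remx w) (Remx v) +
        (bilin (Immx v) (Immx w) + bilin (Immx w) (Immx v))) => s.
rewrite /complexified_form.
have -> : Remx (v + real_complex R s *: w) = 1 *: Remx v + s *: Remx w.
  apply/rowP => j; rewrite !mxE mul1r; case: (v 0 j) (w 0 j) => a b [d e] /=.
  by rewrite mul0r subr0.
have -> : Immx (v + real_complex R s *: w) = 1 *: Immx v + s *: Immx w.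
  apply/rowP => j; rewrite !mxE mul1r; case: (v 0 j) (w 0 j) => a b [d e] /=.
  by rewrite mul0r addr0.
by rewrite !bilin_comb; ring.
Qed.

Hypothesis posP : posdefmx P.

Lemma bilin_gt0 x : x != 0 -> 0 < bilin x x.
Proof. by move=> x0; have := posP.2 x^T; rewrite trmx_eq0 trmxK; apply. Qed.

Lemma bilin_ge0 x : 0 <= bilin x x.
Proof.
have [->|/bilin_gt0/ltW //] := eqVneq x 0.
by rewrite /bilin !mul0mx mxE.
Qed.

Lemma complexified_form_gt0 v : v != 0 -> 0 < complexified_form v.
Proof.
move=> v0; rewrite /complexified_form.
have [Re0|/bilin_gt0 Re0] := eqVneq (Remx v) 0; last first.
  by rewrite ltr_wpDr ?bilin_ge0.
apply: ltr_wpDl; first exact: bilin_ge0.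
apply: bilin_gt0; apply: contraNneq v0 => Im0.
apply/eqP/rowP => j; move/rowP/(_ j): Re0; move/rowP/(_ j): Im0.
by rewrite !mxE; case: (v 0 j) => a b /= -> ->.
Qed.

Variables (A : 'M[R]_n) (k : R).
Hypothesis leAP : loewner_le (A^T *m P *m A) (k *: P).

Lemma complexified_form_mulmx v :
  complexified_form (v *m (complexmx A)^T) <= k * complexified_form v.
Proof.
have le x : bilin (x *m A^T) (x *m A^T) <= k * bilin x x.
  have := leAP.2 x^T; rewrite mulmxBr mulmxBl mxE [X in _ + X]mxE subr_ge0
    trmxK.
  by rewrite -scalemxAr -scalemxAl [X in _ <= X]mxE /bilin trmx_mul trmxK
    !mulmxA.
by rewrite /complexified_form /complexmx map_trmx Remx_mulr Immx_mulr mulrDr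
  lerD.
Qed.

(** At an eigenvector the form is multiplied by exactly [sqc a], and its positive value cancels. *)
Lemma loewner_le_eigenvalue a : eigenvalue (complexmx A)^T a -> sqc a <= k.
Proof.
move=> /eigenvalueP[v vA /complexified_form_gt0 v0].
have := complexified_form_mulmx v.
by rewrite vA complexified_formZ ler_pM2r.
Qed.

(* With [v M = a (v + z)] and [z M = a z], the form would be nonincreasing along
   [v + z, v + 2 z, ...], although it is a quadratic polynomial with positive
   leading coefficient. *)
Lemma loewner_le_ascent a : 0 < k -> sqc a = k -> ascent_le1 (complexmx A)^T a.
Proof.
move=> k0 ak v; set y := v *m _ => yM; apply/eqP/negPn/negP => y0.
have a0 : a != 0 by rewrite -sqc_eq0 ak gt_eqF.
(* Dividing by [a] makes each application of the matrix shift the parameter of the line by exactly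
   1, up to the factor [a]. *)
pose z := a^-1 *: y.
have z0 : z != 0 by rewrite scaler_eq0 invr_eq0 negb_or a0.
have az : a *: z = y by rewrite scalerA divff ?scale1r.
have yA : y *m (complexmx A)^T = a *: y.
  by apply/eqP; rewrite -subr_eq0 -mul_mx_scalar -mulmxBr yM.
have zA : z *m (complexmx A)^T = a *: z by rewrite -scalemxAl yA scalerA mulrC
  -scalerA.
have vA : v *m (complexmx A)^T = a *: v + a *: z.
  by rewrite az /y mulmxBr mul_mx_scalar addrC subrK.
have step (s : R) : complexified_form (v + real_complex R (s + 1) *: z) <=
                    complexified_form (v + real_complex R s *: z).
  have := complexified_form_mulmx (v + real_complex R s *: z).
  rewrite mulmxDl -scalemxAl zA vA.
  have -> : a *: v + a *: z + real_complex R s *: (a *: z) =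
            a *: (v + real_complex R (s + 1) *: z).
    by rewrite rmorphD rmorph1 !scalerDr scalerDl scale1r scalerDr !scalerA [_
      * a]mulrC -addrA [X in _ + X]addrC.
  by rewrite complexified_formZ ak ler_pM2l.
have [q qE] := complexified_form_line v z.
have h0 := complexified_form_gt0 z0.
(* This parameter is the minimum of the quadratic polynomial; moving on by 1 raises the value by
   [complexified_form z], which is positive. *)
have := step (- q / (2 * complexified_form z)); rewrite !qE.
move: (complexified_form z) h0 => h h0; move: (complexified_form v) => p.
rewrite -subr_ge0.
set d := (X in 0 <= X); have -> : d = - h by rewrite /d; field; rewrite gt_eqF.
by rewrite oppr_ge0 leNgt h0.
Qed.

End Complexification.
End RealImaginaryParts.

(** * Hilbert norms *)

Section DotOfMatrix.
Variables (R : rcfType) (n : nat) (P : 'M[R]_n).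
Hypothesis posP : posdefmx P.

(** A named function, so that the instances below can give it the inner product structure that
    [hilbert_norm] asks for. *)
Definition dot_of_mx (x y : 'cV[R]_n) : R := (x^T *m P *m y) 0 0.

Let dot_of_mx_bilinear : bilinear_for
  (GRing.Scale.Law.clone _ _ *%R _) (GRing.Scale.Law.clone _ _ (idfun \; *%R) _)
  dot_of_mx.
Proof.
split=> [y|x] a u v; rewrite /dot_of_mx.
  by rewrite linearP /= !mulmxDl -!scalemxAl !mxE.
by rewrite mulmxDr -scalemxAr !mxE.
Qed.

HB.instance Definition _ := bilinear_isBilinear.Build R _ _ _
  (GRing.Scale.Law.clone _ _ *%R _) (GRing.Scale.Law.clone _ _ (idfun \; *%R) _)
  dot_of_mx dot_of_mx_bilinear.

Let dot_of_mx_sym x y : dot_of_mx x y = (-1) ^+ false * idfun (dot_of_mx y x).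
Proof.
rewrite expr0 mul1r; transitivity ((x^T *m P *m y)^T 0 0); first by rewrite mxE.
by rewrite !trmx_mul trmxK (symmetricmxP _ posP.1) mulmxA.
Qed.

HB.instance Definition _ := isHermitianSesquilinear.Build R _ _ _
  dot_of_mx dot_of_mx_sym.

Let dot_of_mx_gt0 x : x != 0 -> 0 < dot_of_mx x x.
Proof. exact: posP.2. Qed.

HB.instance Definition _ := isDotProduct.Build R _ dot_of_mx dot_of_mx_gt0.

Lemma posdefmx_hilbert_norm :
  hilbert_norm (fun x : 'cV[R]_n => Num.sqrt ((x^T *m P *m x) 0 0)).
Proof. by exists dot_of_mx. Qed.

End DotOfMatrix.

Section HilbertNorm.
Variables (R : rcfType) (n : nat).
Implicit Types (A P : 'M[R]_n) (N : 'cV[R]_n -> R).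

Lemma hilbert_norm_ge0 N x : hilbert_norm N -> 0 <= N x.
Proof. by move=> [ip ->]; exact: sqrtr_ge0. Qed.

Lemma lipschitz_wrt_mulmx N A (l : R) :
  (forall x, N (A *m x) <= l * N x) -> lipschitz_wrt N l (fun x => A *m x).
Proof. by move=> NA x y; rewrite -mulmxBr. Qed.

(** [P] is the Gram matrix of the inner product in the standard basis; the matrix inequality is then
    the square of the Lipschitz bound between [x] and 0. *)
Lemma lipschitz_loewner N A (l : R) : 0 <= l -> hilbert_norm N ->
  lipschitz_wrt N l (fun x => A *m x) ->
  exists2 P, posdefmx P & loewner_le (A^T *m P *m A) (l ^+ 2 *: P).
Proof.
move=> l0 [ip NE] NA; pose P : 'M[R]_n := \matrix_(i, j) ip (delta_mx i 0)
  (delta_mx j 0).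
have PE x y : (x^T *m P *m y) 0 0 = ip x y.
  rewrite [x in RHS]matrix_sum_delta [y in RHS]matrix_sum_delta.
  rewrite !mxE linear_sumr; apply: eq_bigr => j _; rewrite big_ord1.
  rewrite linearZr_LR linear_sumlz /= !mxE mulrC; congr (_ * _).
  by apply: eq_bigr => i _; rewrite big_ord1 linearZl_LR !mxE.
have sP : P^T = P by apply/matrixP => i j;
  rewrite !mxE hermitian_subproof expr0 mul1r.
have ip_ge0 x : 0 <= ip x x.
  have [->|/(@neq0_dnorm_gt0 _ _ _ ip)/ltW //] := eqVneq x 0.
  by rewrite -PE mulmx0 mxE.
exists P; split=> [|x].
- exact/symmetricmxP.
- by move=> x0; rewrite PE neq0_dnorm_gt0.
- by apply/symmetricmxP; rewrite linearB linearZ /= !trmx_mul trmxK sP mulmxA.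
have -> : (x^T *m (l ^+ 2 *: P - A^T *m P *m A) *m x) 0 0 =
          l ^+ 2 * (x^T *m P *m x) 0 0 - ((A *m x)^T *m P *m (A *m x)) 0 0.
  rewrite mulmxBr mulmxBl mxE [X in _ + X]mxE -scalemxAr -scalemxAl.
  by rewrite [X in X - _]mxE trmx_mul !mulmxA.
rewrite !PE subr_ge0; have := NA x 0; rewrite mulmx0 !subr0 !NE => leA.
suff : Num.sqrt (ip (A *m x) (A *m x)) ^+ 2 <= (l * Num.sqrt (ip x x)) ^+ 2.
  by rewrite exprMn !sqr_sqrtr.
by rewrite ler_sqr ?nnegrE ?mulr_ge0 ?sqrtr_ge0.
Qed.

Lemma loewner_lipschitz A P (l : R) : 0 <= l -> posdefmx P ->
  loewner_le (A^T *m P *m A) (l ^+ 2 *: P) ->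
  exists2 N, hilbert_norm N & lipschitz_wrt N l (fun x => A *m x).
Proof.
move=> l0 posP leAP.
exists (fun x => Num.sqrt ((x^T *m P *m x) 0 0));
  first exact: posdefmx_hilbert_norm.
apply: lipschitz_wrt_mulmx => x.
rewrite -[l in X in _ <= X](ger0_norm l0) -sqrtr_sqr -sqrtrM ?sqr_ge0 //
  ler_wsqrtr //.
have := leAP.2 x; rewrite mulmxBr mulmxBl mxE [X in _ + X]mxE subr_ge0.
by rewrite -scalemxAr -scalemxAl [X in _ <= X]mxE trmx_mul !mulmxA.
Qed.

(** The algebraic multiplicity is taken on [M] and the geometric one on its transpose; both matrices
    have the same characteristic polynomial. *)
Lemma semi_simpleP (F : fieldType) (M : 'M[F]_n) a :
  semi_simple M a <-> ascent_le1 M^T a.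
Proof.
rewrite -mup_eigenspace_ascent /semi_simple /algebraic_mult /geometric_mult.
by rewrite /char_poly -det_tr /char_poly_mx linearB /= tr_scalar_mx map_trmx.
Qed.

(** Condition (iii) as the theorem spells it out, so the two agree by unfolding. *)
Definition spectral_condition A (l : R) : Prop :=
  forall a : R[i], col_eigenvalue (complexmx A) a ->
    `|a| <= real_complex R l /\
    (`|a| = real_complex R l -> semi_simple (complexmx A) a).

Lemma loewner_spectral A P (l : R) : 0 < l -> posdefmx P ->
  loewner_le (A^T *m P *m A) (l ^+ 2 *: P) -> spectral_condition A l.
Proof.
move=> l0 posP leAP a ea; rewrite normc_le_sqc ?(normc_eq_sqc _ (ltW l0))
  ?(ltW l0) //.
split=> [|al]; first exact: (loewner_le_eigenvalue posP leAP).
apply/semi_simpleP; apply: (loewner_le_ascent posP leAP _ al).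
by rewrite exprn_gt0.
Qed.

Lemma spectral_loewner A (l : R) : 0 < l -> spectral_condition A l ->
  exists2 P, posdefmx P & loewner_le (A^T *m P *m A) (l ^+ 2 *: P).
Proof.
move=> l0 specA; apply: bounded_upto_basis_loewner.
apply: bounded_upto_basis_le => [|a ea|a ea al]; first by rewrite exprn_gt0.
  by rewrite -normc_le_sqc ?(ltW l0) //; have [] := specA a ea.
by apply/semi_simpleP; have [_] := specA a ea; apply;
  apply/(normc_eq_sqc _ (ltW l0)).
Qed.

Lemma spectral_lipschitz A (l : R) : 0 < l -> spectral_condition A l ->
  exists2 N, hilbert_norm N & lipschitz_wrt N l (fun x => A *m x).
Proof.
by move=> l0 /(spectral_loewner l0) [P]; apply: loewner_lipschitz; exact: ltW.
Qed.

End HilbertNorm.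

Theorem lemma3 (R : realType) (n : nat) (A : 'M[R]_n) :
  (forall l : R, 0 < l < 1 ->
     [<-> (exists2 N : 'cV[R]_n -> R,
             hilbert_norm N & contraction_wrt N l (fun x => A *m x));
          (exists2 P : 'M[R]_n,
             posdefmx P & loewner_le (A^T *m P *m A) (l ^+ 2 *: P));
          (forall a : R[i], col_eigenvalue (complexmx A) a ->
             `|a| <= real_complex R l /\
             (`|a| = real_complex R l -> semi_simple (complexmx A) a)) ])
  /\
  [<-> (exists2 N : 'cV[R]_n -> R,
          hilbert_norm N & lipschitz_wrt N 1 (fun x => A *m x));
       (exists2 P : 'M[R]_n,
          posdefmx P & loewner_le (A^T *m P *m A) (1 ^+ 2 *: P));
       (forall a : R[i], col_eigenvalue (complexmx A) a ->
          `|a| <= real_complex R 1 /\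
          (`|a| = real_complex R 1 -> semi_simple (complexmx A) a));
       (exists2 N : 'cV[R]_n -> R,
          hilbert_norm N & nonexpansive_wrt N (fun x => A *m x)) ].
Proof.
split=> [l /andP[l0 l1]|]; tfae.
- by move=> [N hN [_ NA]]; exact: lipschitz_loewner (ltW l0) hN NA.
- by move=> [P posP leAP]; exact: loewner_spectral leAP.
- move=> /(spectral_lipschitz l0) [N hN NA]; exists N => //.
  by split; rewrite // ltW.
- by move=> [N hN NA]; exact: lipschitz_loewner hN NA.
- by move=> [P posP leAP]; exact: loewner_spectral leAP.
- move=> /(spectral_lipschitz ltr01) [N hN NA]; exists N => //.
  by exists 1; rewrite ler01 lexx.
(* A Lipschitz constant [l <= 1] can be raised to 1 because [N] is nonnegative. *)
move=> [N hN [l [/andP[l0 l1] NA]]]; exists N => // x y.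
by apply: le_trans (NA x y) _; rewrite ler_wpM2r ?hilbert_norm_ge0.
Qed.
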